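(* Let $(V,\mu)$ and $(E,\tau)$ be positive measure spaces, $M_0:V\times E\to\mathbb{R}$ a $(\mu\times\tau)$-measurable function, $wt:E\to\mathbb{R}$ a $\tau$-measurable function, $I\subseteq\mathbb{R}$ an interval, and $\varphi:I\to\mathbb{R}$ a function such that $f(t)=t\varphi(t)$ is strictly convex on $I$. Suppose that: (i) $0<\mu(V)<\infty$; (ii) $0<s:=\int_E wt\,d\tau<\infty$; (iii) $\int_{V\times E}|M_0(v,e)|\,|wt(e)|\,d(\mu\times\tau)<\infty$; (iv) for some real number $c$, $\int_V M_0(v,e)\,d\mu(v)=c$ for $\tau$-almost all $e\in E$; (v) for $\mu$-almost all $v\in V$, $\delta_0(v):=\int_E M_0(v,e)\,wt(e)\,d\tau(e)\in I$; (vi) $\int_{V\times E}|\varphi(\delta_0(v))|\,|M_0(v,e)|\,|wt(e)|\,d(\mu\times\tau)<\infty$. Let $\bar\delta=\frac{1}{\mu(V)}\int_V\delta_0\,d\mu=\frac{cs}{\mu(V)}$. Call a $\mu$-integrable function $\delta:V\to\mathbb{R}$ admissible if $\delta(v)\in I$ for $\mu$-a.e. $v$, $f\circ\delta$ is $\mu$-integrable, and $\int_V\delta\,d\mu=cs$. For admissible $\delta$ define $$\mathcal F(\delta)=\frac1s\int_V f(\delta(v))\,d\mu(v).$$ Then an admissible $\delta$ attains the global minimum of $\mathcal F$ over all admissible functions if and only if $\delta(v)=\bar\delta$ for $\mu$-a.e. $v\in V$.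
   Context: $\mu\times\tau$ denotes the product measure on $V\times E$. When $\delta(v)=\int_E M(v,e)\,wt(e)\,d\tau(e)$ for a kernel $M$ satisfying (iii)-(vi) in place of $M_0$ (with the same $c$), the functional is equivalently $\mathcal F(\delta)=\frac1s\int_{V\times E}\varphi(\delta(v))\,M(v,e)\,wt(e)\,d(\mu\times\tau)$. *)

(* Defs.v *)
From HB Require Import structures.
From mathcomp Require Import all_boot all_order all_algebra.
From mathcomp Require Import all_classical all_reals all_analysis.

Set Implicit Arguments.
Unset Strict Implicit.
Unset Printing Implicit Defensive.

Import Order.TTheory GRing.Theory Num.Theory.
Import numFieldNormedType.Exports.

Local Open Scope classical_set_scope.
Local Open Scope ring_scope.

Definition strictly_convex_on (R : realType) (I : interval R) (f : R -> R) :=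
  forall x y t : R, x \in I -> y \in I -> x != y -> 0 < t < 1 ->
    f ((1 - t) * x + t * y) < (1 - t) * f x + t * f y.

Definition weighted_degree (R : realType) (d1 d2 : measure_display)
    (V : measurableType d1) (E : measurableType d2)
    (tau : {measure set E -> \bar R}) (M : V * E -> R) (wt : E -> R) (v : V) : R :=
  \int[tau]_e (M (v, e) * wt e).

(* A function on the interval I is encoded as a total function R -> R of which
   only the values on I may matter. As delta takes its values in I only almost
   everywhere, f \o delta is only defined on the conull set
   delta @^-1` [set` I], and this is where it is integrated below. *)

Definition admissible (R : realType) (d : measure_display) (V : measurableType d)
    (mu : {measure set V -> \bar R}) (I : interval R) (f : R -> R) (total : R)
    (delta : V -> R) : Prop :=
  [/\ mu.-integrable [set: V] (EFin \o delta),
      {ae mu, forall v, delta v \in I},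
      mu.-integrable (delta @^-1` [set` I]) (EFin \o (f \o delta)) &
      \int[mu]_v delta v = total].

Definition objective (R : realType) (d : measure_display) (V : measurableType d)
    (mu : {measure set V -> \bar R}) (I : interval R) (f : R -> R) (s : R)
    (delta : V -> R) : R :=
  s^-1 * \int[mu]_(v in delta @^-1` [set` I]) f (delta v).

(* Main.v *)
(* By Fubini the mean of delta0 is c s / mu V. If f admits at this mean x a
   strict support a (f t - f x) + b (t - x) > 0 for t <> x in I, integrating it
   along an admissible delta kills the affine term, so that
   a (\int f (delta) - f x mu V) is nonnegative and vanishes only when delta is
   almost everywhere x. The case a = 0 covers a mean that is not interior to I:
   it then forces every admissible function to be almost everywhere x. *)

Require Import Defs.
From HB Require Import structures.
From mathcomp Require Import all_boot all_order all_algebra.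
From mathcomp Require Import all_classical all_reals all_analysis.
From mathcomp Require Import measurable_realfun ring lra.

Import Order.TTheory GRing.Theory Num.Theory.
Import numFieldNormedType.Exports.

Local Open Scope classical_set_scope.
Local Open Scope ring_scope.

(** * Strictly convex functions: slopes and strict supports *)

(** The point [d] is the convex combination of [x] and [y] with weight [(d - x) / (y - x)] on [y];
    clear denominators. Slopes to the left of [d] are thus bounded above, so they have a finite
    supremum. *)
Lemma strictly_convex_chord (R : realType) (I : interval R) (f : R -> R)
    (x d y : R) :
  strictly_convex_on I f -> x \in I -> y \in I -> x < d -> d < y ->
  (f d - f x) / (d - x) <= (f y - f d) / (y - d).
Proof.
move=> fconv xI yI xd dy.
have xy : x < y by exact: lt_trans dy.
have dx0 : 0 < d - x by rewrite subr_gt0.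
have yd0 : 0 < y - d by rewrite subr_gt0.
have yx0 : 0 < y - x by rewrite subr_gt0.
have xNy : x != y by rewrite lt_eqF.
have t01 : 0 < (d - x) / (y - x) < 1.
  by rewrite divr_gt0//= ltr_pdivrMr// mul1r ltrD2r.
have := fconv x y _ xI yI xNy t01.
have -> : (1 - (d - x) / (y - x)) * x + (d - x) / (y - x) * y = d.
  by field; rewrite gt_eqF.
have -> : (1 - (d - x) / (y - x)) * f x + (d - x) / (y - x) * f y =
          ((y - d) * f x + (d - x) * f y) / (y - x).
  by field; rewrite gt_eqF.
rewrite ltr_pdivlMr// => fd.
rewrite ler_pdivrMr// mulrAC ler_pdivlMr//; nra.
Qed.

(* When [I] lies on one side of [d], the weight [a] is zero and the affine
   term alone is positive; otherwise [- b] is a subgradient of [f] at [d]. *)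
Lemma strictly_convex_support (R : realType) (I : interval R) (f : R -> R)
    (d : R) :
  strictly_convex_on I f ->
  exists a b : R, [/\ 0 <= a, a != 0 -> d \in I &
    forall t, t \in I -> t != d -> 0 < a * (f t - f d) + b * (t - d)].
Proof.
move=> fconv.
have [[y yI dy]|noy] := pselect (exists2 y, y \in I & d < y); last first.
  exists 0, (-1); split => [//||t tI td]; first by rewrite eqxx.
  have : t < d.
    by rewrite lt_neqAle td/= leNgt; apply/negP => dt; apply: noy; exists t.
  by lra.
have [[x xI xd]|nox] := pselect (exists2 x, x \in I & x < d); last first.
  exists 0, 1; split => [//||t tI td]; first by rewrite eqxx.
  have : d < t.
    rewrite lt_neqAle eq_sym td/= leNgt.
    by apply/negP => dt; apply: nox; exists t.
  by lra.
have Iconv u v w : u \in I -> w \in I -> u <= v <= w -> v \in I.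
  by move=> uI wI; exact: (@interval_is_interval _ I u w).
have dI : d \in I by apply: (Iconv x _ y) => //; rewrite !ltW.
(* The supremum [k] of the left slopes at [d] lies between all left slopes and all right slopes,
   hence is a subgradient; this gives [weak]. *)
pose S := [set (f d - f u) / (d - u) | u in [set u | u \in I /\ u < d]].
have Sub w : w \in I -> d < w -> ubound S ((f w - f d) / (w - d)).
  by move=> wI dw _ [u [uI ud] <-]; exact: (strictly_convex_chord _ _ _ _ _ _ fconv).
have Sne : S !=set0 by exists ((f d - f x) / (d - x)), x.
have Ssup : has_sup S by split=> //; exists ((f y - f d) / (y - d)); exact: Sub.
pose k := sup S.
have weak t : t \in I -> 0 <= f t - f d - k * (t - d).
  move=> tI; rewrite subr_ge0; have [td|dt|->] := ltgtP t d.
  - have : (f d - f t) / (d - t) <= k by apply: sup_upper_bound => //; exists t.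
    by rewrite ler_pdivrMr ?subr_gt0//; nra.
  - have : k <= (f t - f d) / (t - d) by apply: ge_sup => //; exact: Sub.
    by rewrite ler_pdivlMr ?subr_gt0.
  - by rewrite !subrr mulr0.
(* Strictness comes from the midpoint of [t] and [d]: there [f] is strictly below the mean of [f t]
   and [f d], yet still above the supporting line. *)
exists 1, (- k); split => // t tI td.
have h : 0 < (2^-1 : R) < 1 by apply/andP; split; lra.
have fm := fconv t d _ tI dI td h.
have := weak ((1 - 2^-1) * t + 2^-1 * d).
have mI : (1 - 2^-1) * t + 2^-1 * d \in I.
  have [td'|/ltW dt'] := leP t d.
    by apply: (Iconv t _ d) => //; apply/andP; split; lra.
  by apply: (Iconv d _ t) => //; apply/andP; split; lra.
by move=> /(_ mI); nra.
Qed.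

(** * Integration over conull sets *)

Lemma conull_Rintegral {d : measure_display} {T : measurableType d} {R : realType}
    (mu : {measure set T -> \bar R}) (D : set T) (g : T -> R) :
  measurable D -> {ae mu, forall x, D x} ->
  mu.-integrable [set: T] (EFin \o g) ->
  \int[mu]_(x in D) g x = \int[mu]_x g x.
Proof.
move=> mD aeD ig; rewrite /Rintegral.
have mDC : measurable (~` D) by exact: measurableC.
rewrite [in RHS](negligible_integral mDC)// ?setTD ?setCK//.
by apply/negligibleP.
Qed.

Lemma conull_measure {d : measure_display} {T : measurableType d} {R : realType}
    (mu : {measure set T -> \bar R}) (D : set T) :
  measurable D -> {ae mu, forall x, D x} -> mu D = mu [set: T].
Proof.
move=> mD aeD; rewrite -(setUv D) measureU ?setICr//; last exact: measurableC.
rewrite [X in (_ + X)%E](_ : _ = 0%E) ?adde0//.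
by apply/negligibleP => //; exact: measurableC.
Qed.

Lemma measurable_preimage_itv {d : measure_display} {T : measurableType d}
    {R : realType} (I : interval R) (delta : T -> R) :
  measurable_fun [set: T] delta -> measurable (delta @^-1` [set` I]).
Proof. by move=> md; rewrite -[X in measurable X]setTI; exact: md. Qed.

(** * Jensen's inequality with its equality case, and constant functions *)

(** The total is written [x * fine (mu [set: V])] to make [x] the mean. The point [x] may lie
    outside [I], so one statement serves both kinds of support: for [a = 0] the premise
    [a * gap = 0] is automatic. *)
Lemma admissible_jensen {R : realType} {d : measure_display}
    {V : measurableType d} (mu : {finite_measure set V -> \bar R})
    (I : interval R) (f : R -> R) (x a b : R) (delta : V -> R) :
  (forall t, t \in I -> t != x -> 0 < a * (f t - f x) + b * (t - x)) ->
  admissible mu I f (x * fine (mu [set: V])) delta ->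
  let gap := \int[mu]_(v in delta @^-1` [set` I]) f (delta v)
             - f x * fine (mu [set: V]) in
  0 <= a * gap /\ (a * gap = 0 -> {ae mu, forall v, delta v = x}).
Proof.
move=> Qgt0 [idelta aeI ifdelta totdelta] gap.
pose J := delta @^-1` [set` I].
pose Q t := a * (f t - f x) + b * (t - x).
have mJ : measurable J.
  by apply: measurable_preimage_itv; apply/measurable_EFinP/measurable_int/idelta.
have idJ : mu.-integrable J (EFin \o delta).
  by apply: integrableS idelta.
have ic (r : R) : mu.-integrable J (EFin \o cst r).
  exact: finite_measure_integrable_cst.
have i1 : mu.-integrable J (EFin \o (fun v => f (delta v) - f x)).
  by apply: (integrableB _ ifdelta (ic (f x))).
have i2 : mu.-integrable J (EFin \o (fun v => delta v - x)).
  by apply: (integrableB _ idJ (ic x)).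
have i3 : mu.-integrable J (EFin \o (fun v => a * (f (delta v) - f x))).
  by apply: (integrableZl _ a i1).
have i4 : mu.-integrable J (EFin \o (fun v => b * (delta v - x))).
  by apply: (integrableZl _ b i2).
have iQ : mu.-integrable J (EFin \o (Q \o delta)).
  by apply: (integrableD _ i3 i4).
have intQ : \int[mu]_(v in J) Q (delta v) = a * gap.
  rewrite /Q RintegralD// !RintegralZl//.
  rewrite (RintegralB mJ ifdelta (ic (f x))) (RintegralB mJ idJ (ic x)).
  rewrite !Rintegral_cst// (conull_measure mu J)// (conull_Rintegral mu J delta)//.
  by rewrite totdelta subrr mulr0 addr0.
have Qge0 t : t \in I -> 0 <= Q t.
  move=> tI; have [->|tx] := eqVneq t x; first by rewrite /Q !subrr !mulr0 addr0.
  by rewrite ltW// Qgt0.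
split; first by rewrite -intQ; apply: Rintegral_ge0 => v Jv; exact: Qge0.
rewrite -intQ => Q0.
(* A nonnegative function with zero integral vanishes almost everywhere, and [Q] is positive on [I]
   away from [x]. *)
have : ae_eq mu J (EFin \o (Q \o delta)) (cst 0%E).
  apply/ae_eq_integral_abs => //; first exact: measurable_int iQ.
  rewrite (eq_integral (EFin \o (Q \o delta))).
    by rewrite -[LHS]fineK ?integrable_fin_num// [fine _]Q0.
  by move=> v /set_mem Jv /=; rewrite ger0_norm ?Qge0.
move=> Qae; near=> v.
have vI : delta v \in I by near: v.
have [//|vx] := eqVneq (delta v) x.
have /(_ vI)/= : J v -> (EFin \o (Q \o delta)) v = cst 0%E v by near: v; exact: Qae.
by case => Qv; have := Qgt0 _ vI vx; rewrite -/(Q _) Qv ltxx.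
Unshelve. all: by end_near. Qed.

Lemma ae_cst_objective {R : realType} {d : measure_display}
    {V : measurableType d} (mu : {measure set V -> \bar R})
    (I : interval R) (f : R -> R) (x total : R) (delta : V -> R) :
  admissible mu I f total delta -> {ae mu, forall v, delta v = x} ->
  \int[mu]_(v in delta @^-1` [set` I]) f (delta v) = f x * fine (mu [set: V]).
Proof.
move=> [idelta aeI ifdelta _] aex.
have mJ : measurable (delta @^-1` [set` I]).
  by apply: measurable_preimage_itv; apply/measurable_EFinP/measurable_int/idelta.
rewrite -(conull_measure mu _ mJ)// -Rintegral_cst//; congr fine.
apply: ae_eq_integral => //; first exact: measurable_int ifdelta.
by apply: filterS aex => v /= -> _.
Qed.

Lemma cst_admissible {R : realType} {d : measure_display}
    {V : measurableType d} (mu : {finite_measure set V -> \bar R})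
    (I : interval R) (f : R -> R) (x : R) :
  x \in I -> admissible mu I f (x * fine (mu [set: V])) (cst x).
Proof.
move=> xI; split.
- exact: finite_measure_integrable_cst.
- exact: aeW.
- apply: (finite_measure_integrable_cst mu (f x)).
  by apply: measurable_preimage_itv.
- by rewrite Rintegral_cst.
Qed.

(** * Fubini's theorem with an arbitrary second measure *)

(** The integral is that of the positive part minus that of the negative part, and the difference of
    two infinities is infinite by convention; a finite value forces both to be finite. *)
Lemma fin_integral_integrable {d : measure_display} {T : measurableType d}
    {R : realType} (mu : {measure set T -> \bar R}) (D : set T) (g : T -> R) :
  measurable D -> measurable_fun D g ->
  (\int[mu]_(x in D) (g x)%:E)%E \is a fin_num ->
  mu.-integrable D (EFin \o g).
Proof.
move=> mD mg gfin; apply/integrableP; split; first exact/measurable_EFinP.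
by rewrite /= integral_fin_num_abs.
Qed.

(** An integrable function is finite almost everywhere, so [fine] alters it on a null set only. This
    links the real-valued degree to the extended-real partial integral of Fubini's theorem. *)
Lemma integrable_fine {d : measure_display} {T : measurableType d}
    {R : realType} (mu : {measure set T -> \bar R}) (D : set T)
    (g : T -> \bar R) :
  measurable D -> mu.-integrable D g ->
  mu.-integrable D (EFin \o (fine \o g)) /\
  (\int[mu]_(x in D) (fine (g x))%:E = \int[mu]_(x in D) g x)%E.
Proof.
move=> mD ig; have mg := measurable_int _ ig.
have mfg : measurable_fun D (EFin \o (fine \o g)).
  exact/measurable_EFinP/measurableT_comp.
have fg : ae_eq mu D (EFin \o (fine \o g)) g.
  by have := integrable_ae mD ig; apply: filterS => x /[apply] /fineK.
split; last exact: ae_eq_integral.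
apply/integrableP; split => //.
rewrite (ae_eq_integral (abse \o g)) //; first by case/integrableP : ig.
- exact: measurableT_comp.
- exact: measurableT_comp.
- exact: ae_eq_abse.
Qed.

(** The sets where [g] is at least [1 / (n + 1)] in absolute value exhaust the support and have
    finite measure. Adding the complement of the support, null for the restricted measure, makes
    them cover [T]. *)
Lemma integrable_support_sigma_finite {d : measure_display}
    {T : measurableType d} {R : realType} (mu : {measure set T -> \bar R})
    (g : T -> R) (mS : measurable [set x | g x != 0]) :
  mu.-integrable [set: T] (EFin \o g) -> sigma_finite [set: T] (mrestr mu mS).
Proof.
move=> ig; have mg : measurable_fun [set: T] g.
  exact/measurable_EFinP/measurable_int/ig.
have mF n : measurable [set x | (n.+1%:R^-1%:E <= `|(EFin \o g) x|)%E].
  rewrite -[X in measurable X]setTI; apply: emeasurable_fun_c_infty => //.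
  by apply: measurableT_comp => //; exact/measurable_EFinP.
exists (fun n => ~` [set x | g x != 0] `|`
                 [set x | (n.+1%:R^-1%:E <= `|(EFin \o g) x|)%E]).
  apply/seteqP; split => // x _.
  have [gx0|gx0] := eqVneq (g x) 0.
    by exists 0%N => //; left => /=; rewrite gx0 eqxx.
  have g0 : 0 < `|g x| by rewrite normr_gt0.
  have [n _ /(_ n (leqnn n)) gn] := near_infty_natSinv_lt (PosNum g0).
  by exists n => //; right; rewrite /= lee_fin ltW.
move=> n; split; first exact/measurableU/mF/measurableC.
rewrite /mrestr setIUl setICl set0U.
set B := [set x | _] in mF *.
apply: (le_lt_trans (measureIl mu (mF n) mS)).
have n0 : 0 < n.+1%:R^-1 :> R by rewrite invr_gt0.
(* Markov's inequality at level [1 / (n + 1)]. *)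
have := @le_integral_comp_abse _ _ _ mu _ measurableT (EFin \o g) _ id
  (@measurable_id _ _ _) (fun _ => id) (fun _ _ _ _ => id)
  (measurable_int _ ig) n0.
rewrite setTI => muB; rewrite -(@lte_pmul2l _ n.+1%:R^-1%:E)//.
apply: le_lt_trans muB _.
by rewrite mulry gtr0_sg// mul1e; case/integrableP : ig.
Qed.

(** By uniqueness of the product of sigma-finite measures, the left side can also be computed by
    integrating the [mu]-measure of sections against [nu], and that integral is monotone in the
    measure. It carries integrability over to [mu \x nu]. *)
Lemma le_product_measure {d1 d2 : measure_display} {V : measurableType d1}
    {E : measurableType d2} {R : realType}
    (mu : {sigma_finite_measure set V -> \bar R})
    (nu : {sigma_finite_measure set E -> \bar R})
    (tau : {measure set E -> \bar R}) :
  (forall A, measurable A -> nu A <= tau A)%E ->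
  forall A, measurable A -> ((mu \x nu) A <= (mu \x^ tau) A)%E.
Proof.
move=> nutau A mA.
have -> : (mu \x nu)%E A = (mu \x^ nu)%E A.
  by apply: product_measure_unique => // B C mB mC /=; rewrite product_measure2E.
apply: ge0_le_measure_integral => //.
exact: measurable_fun_ysection.
Qed.

Lemma integral_mrestr_support {d : measure_display} {T : measurableType d}
    {R : realType} (mu : {measure set T -> \bar R}) (g : T -> R)
    (mS : measurable [set x | g x != 0]) (h : T -> \bar R) :
  (forall x, g x = 0 -> h x = 0%E) ->
  (\int[mrestr mu mS]_x h x = \int[mu]_x h x)%E.
Proof.
move=> h0.
have hS : h = h \_ [set x | g x != 0].
  apply/funext => x; rewrite patchE; case: ifPn => //.
  by rewrite notin_setE/= => /negP/negPn/eqP/h0.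
rewrite hS -!integral_mkcond; apply: eq_measure_integral => A mA AS.
by rewrite /= /mrestr setIidl.
Qed.

(* [tau] is arbitrary, but its restriction to the support of [wt] is
   sigma-finite, which is what Fubini's theorem needs. *)
Lemma weighted_degree_integral {R : realType} {d1 d2 : measure_display}
    {V : measurableType d1} {E : measurableType d2}
    (mu : {finite_measure set V -> \bar R}) (tau : {measure set E -> \bar R})
    (M : V * E -> R) (wt : E -> R) (c s : R) :
  measurable_fun [set: V * E] M -> measurable_fun [set: E] wt ->
  (\int[tau]_e (wt e)%:E)%E = s%:E ->
  (\int[(mu \x^ tau)%E]_z (`|M z| * `|wt z.2|)%:E < +oo)%E ->
  {ae tau, forall e, (\int[mu]_v (M (v, e))%:E)%E = c%:E} ->
  (\int[mu]_v weighted_degree tau M wt v) = c * s.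
Proof.
move=> mM mwt intwt hM hc.
have iwt : tau.-integrable [set: E] (EFin \o wt).
  by apply: fin_integral_integrable => //; rewrite intwt.
have mS : measurable [set e | wt e != 0].
  rewrite (_ : mkset _ = setT `&` wt @^-1` (~` [set 0])); last first.
    by apply/seteqP; split => e /=; [move/eqP|case=> _ /eqP].
  by apply: mwt => //; exact: measurableC.
have nusf := integrable_support_sigma_finite tau wt mS iwt.
pose nu : {sigma_finite_measure set E -> \bar R} :=
  HB.pack_for (SigmaFiniteMeasure.type E R) (mrestr tau mS)
   (Measure_isSigmaFinite.Build _ _ _ (mrestr tau mS) nusf).
have nutau A : measurable A -> (nu A <= tau A)%E.
  by move=> mA; exact: measureIl.
have intnu (h : E -> \bar R) : (forall e, wt e = 0 -> h e = 0%E) ->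
    (\int[nu]_e h e = \int[tau]_e h e)%E.
  by exact: integral_mrestr_support.
pose h (z : V * E) := (M z * wt z.2)%:E.
have mh : measurable_fun [set: V * E] h.
  apply/measurable_EFinP; apply: measurable_funM => //.
  exact: measurableT_comp.
have ih : (mu \x nu)%E.-integrable [set: V * E] h.
  apply/integrableP; split => //; apply: le_lt_trans hM.
  under eq_integral do rewrite /h /= normrM.
  apply: ge0_le_measure_integral => //.
  - exact: le_product_measure.
  - apply/measurable_EFinP; apply: measurable_funM; first exact: measurableT_comp.
    by apply: measurableT_comp => //; exact: measurableT_comp.
have hF v : weighted_degree tau M wt v = fine (fubini_F nu h v).
  congr fine; rewrite /fubini_F intnu// => e we0.
  by rewrite /h /= we0 mulr0.
have iF := integrable_fubini_F ih.
rewrite /Rintegral; under eq_integral do rewrite hF.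
rewrite (integrable_fine _ _ _ _ iF).2//.
rewrite integral12_prod_meas1// -integral21_prod_meas1//.
(* A [tau]-null exceptional set is [nu]-null because [nu] is below [tau]. *)
have hcnu : {ae nu, forall e, (\int[mu]_v (M (v, e))%:E)%E = c%:E}.
  have [N [mN N0 subN]] := hc; exists N; split => //.
  by apply/eqP; rewrite -measure_le0 -N0; exact: nutau.
rewrite (ae_eq_integral (fun e => (c * wt e)%:E))//=.
- rewrite intnu; last by move=> e ->; rewrite mulr0.
  under eq_integral do rewrite EFinM.
  by rewrite integralZl// intwt.
- exact: (measurable_fubini_G ih).
- apply/measurable_EFinP; exact: measurable_funM.
- apply: filterS hcnu => e Me _.
  rewrite /fubini_G /h /=.
  under eq_integral do rewrite EFinM muleC.
  rewrite integralZl//; first by rewrite Me -EFinM mulrC.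
  apply: fin_integral_integrable => //; last by rewrite Me.
  exact: (measurableT_comp mM (pair2_measurable e)).
Qed.

(* mu \x^ tau is the library's product measure on V * E that only asks mu (here
   finite) to be sigma-finite, so that tau is an arbitrary measure. Equations
   between an extended-real integral and a real number include the integrability
   of the integrand. *)
Theorem proposition3p3 (R : realType) (d1 d2 : measure_display)
    (V : measurableType d1) (E : measurableType d2)
    (mu : {finite_measure set V -> \bar R}) (tau : {measure set E -> \bar R})
    (M0 : V * E -> R) (wt : E -> R) (I : interval R) (phi : R -> R) (c s : R)
    (mM0 : measurable_fun [set: V * E] M0) (mwt : measurable_fun [set: E] wt)
    (f := fun t : R => t * phi t)
    (fconvex : strictly_convex_on I f)
    (h1 : (0 < mu [set: V] < +oo)%E)
    (h2 : (\int[tau]_e (wt e)%:E)%E = s%:E) (s_gt0 : 0 < s)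
    (h3 : (\int[(mu \x^ tau)%E]_z (`|M0 z| * `|wt z.2|)%:E < +oo)%E)
    (h4 : {ae tau, forall e, (\int[mu]_v (M0 (v, e))%:E)%E = c%:E})
    (delta0 := weighted_degree tau M0 wt)
    (h5 : {ae mu, forall v, delta0 v \in I})
    (h6 : (\int[(mu \x^ tau)%E]_(z in [set z : V * E | delta0 z.1 \in I])
             (`|phi (delta0 z.1)| * `|M0 z| * `|wt z.2|)%:E < +oo)%E)
    (deltabar := (fine (mu [set: V]))^-1 * \int[mu]_v delta0 v) :
  deltabar = c * s / fine (mu [set: V]) /\
  forall delta : V -> R, admissible mu I f (c * s) delta ->
    ((forall delta' : V -> R, admissible mu I f (c * s) delta' ->
        objective mu I f s delta <= objective mu I f s delta')
     <-> {ae mu, forall v, delta v = deltabar}).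
Proof.
have m_gt0 : 0 < fine (mu [set: V]) by rewrite fine_gt0.
have dbE : deltabar = c * s / fine (mu [set: V]).
  by rewrite /deltabar /delta0 (weighted_degree_integral mu tau M0 wt c s)// mulrC.
split => // delta adm; move: (deltabar) dbE => x xE {deltabar}.
have csE : c * s = x * fine (mu [set: V]) by rewrite xE divfK// gt_eqF.
rewrite csE in adm *.
have [a [b [a0 aI Qgt0]]] := strictly_convex_support R I f x fconvex.
have jensen := admissible_jensen mu I f x a b _ Qgt0.
split => [delta_min|delta_x delta' adm'].
  have [gap_ge0 +] := jensen _ adm; apply.
  (* For [a != 0] the mean lies in [I], so the constant [x] is an admissible competitor, and
     comparing with it makes the gap nonpositive. *)
  have [a_eq0|a_neq0] := eqVneq a 0; first by rewrite a_eq0 mul0r.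
  have adm_x := cst_admissible mu I f x (aI a_neq0).
  have := delta_min _ adm_x.
  rewrite /objective ler_pM2l ?invr_gt0//.
  rewrite [leRHS](ae_cst_objective mu I f x _ _ adm_x); last exact: aeW.
  by rewrite -subr_le0 => gap_le0; apply: le_anti; rewrite gap_ge0 mulr_ge0_le0.
rewrite /objective ler_pM2l ?invr_gt0//.
rewrite (ae_cst_objective mu I f x _ _ adm)//.
have [gap_ge0 gap_eq0] := jensen _ adm'.
(* For [a = 0] the competitor is itself almost everywhere [x], so both objectives agree; otherwise
   divide the inequality by [a > 0]. *)
have [a_eq0|a_neq0] := eqVneq a 0.
  rewrite (ae_cst_objective mu I f x _ _ adm')//.
  by apply: gap_eq0; rewrite a_eq0 mul0r.
by rewrite -subr_ge0 -(pmulr_rge0 _ (_ : 0 < a))// lt_def a_neq0.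
Qed.
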